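(* Let $\Theta\subseteq\mathbb{R}$ and let $X$ be a random variable with probability density function or probability mass function $$f_X(x,\theta)=h(x)\exp\big(\eta(\theta)T(x)-A(\theta)\big),\qquad\theta\in\Theta,$$ where $T,h,\eta,A$ are known functions with $\eta,A$ differentiable on $\Theta$. Let $X_1,\dots,X_n$ be i.i.d. samples of $X$, let $\widehat{\boldsymbol\theta}=\frac1n\sum_{i=1}^nT(X_i)$, and for $z,\theta\in\Theta$ define $$\mathscr{M}(z,\theta)=\left[\frac{\exp(\eta(\theta)z-A(\theta))}{\exp(\eta(z)z-A(z))}\right]^n .$$ Suppose $\frac{d\eta(\theta)}{d\theta}>0$ for $\theta\in\Theta$. Then $$\Pr\{\widehat{\boldsymbol\theta}\ge z\mid\theta\}\le\mathscr{M}(z,\theta)\Pr\{\widehat{\boldsymbol\theta}\ge z\mid z\}\quad\text{for } z,\theta\in\Theta,\ z\ge\theta,$$ $$\Pr\{\widehat{\boldsymbol\theta}\le z\mid\theta\}\le\mathscr{M}(z,\theta)\Pr\{\widehat{\boldsymbol\theta}\le z\mid z\}\quad\text{for } z,\theta\in\Theta,\ z\le\theta.$$ Moreover, if additionally $\frac{dA(\theta)}{d\theta}=\theta\frac{d\eta(\theta)}{d\theta}$ on $\Theta$, then: (i) $\widehat{\boldsymbol\theta}$ is a maximum-likelihood and unbiased estimator of $\theta$; (ii) $\mathscr{M}(z,\theta)=\inf_{t\in\mathbb{R}}\mathbb{E}\big[\exp(nt(\widehat{\boldsymbol\theta}-z))\big]$ (expectation under parameter $\theta$), the infimum being attained at $t=\eta(z)-\eta(\theta)$;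 (iii) for fixed $z\in\Theta$, $\mathscr{M}(z,\theta)$ is increasing in $\theta\in\Theta$ with $\theta\le z$ and decreasing in $\theta\in\Theta$ with $\theta\ge z$; (iv) for fixed $\theta\in\Theta$, $\mathscr{M}(z,\theta)$ is increasing in $z\in\Theta$ with $z\le\theta$ and decreasing in $z\in\Theta$ with $z\ge\theta$; (v) for $z\in\Theta$, $$\Pr\{\widehat{\boldsymbol\theta}\ge z\mid z\}\le\frac12+\frac{C_{\mathrm{BE}}}{\sqrt n}\frac{\mathbb{E}[|T(X)-z|^3]}{\mathbb{E}^{3/2}[|T(X)-z|^2]}\le\frac12+\frac{C_{\mathrm{BE}}}{\sqrt n}\frac{\mathbb{E}^{3/4}[|T(X)-z|^4]}{\mathbb{E}^{3/2}[|T(X)-z|^2]},$$ $$\Pr\{\widehat{\boldsymbol\theta}\le z\mid z\}\le\frac12+\frac{C_{\mathrm{BE}}}{\sqrt n}\frac{\mathbb{E}[|T(X)-z|^3]}{\mathbb{E}^{3/2}[|T(X)-z|^2]}\le\frac12+\frac{C_{\mathrm{BE}}}{\sqrt n}\frac{\mathbb{E}^{3/4}[|T(X)-z|^4]}{\mathbb{E}^{3/2}[|T(X)-z|^2]},$$ where the expectations are taken with parameter $\theta=z$.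
   Context: $\Pr\{\cdot\mid\theta\}$ denotes probability when the samples have parameter $\theta$. $C_{\mathrm{BE}}$ denotes the absolute constant in the Berry–Esseen inequality: for i.i.d. samples $Y_1,Y_2,\dots$ of a random variable $Y$ with $\mathbb{E}[Y]=0$, $\mathbb{E}[Y^2]>0$, $\mathbb{E}[|Y|^3]<\infty$, if $F_n$ is the cdf of $\sum_{i=1}^nY_i/\sqrt{n\mathbb{E}[Y^2]}$ and $\Phi$ the standard normal cdf, then $|F_n(y)-\Phi(y)|\le\frac{C_{\mathrm{BE}}}{\sqrt n}\frac{\mathbb{E}[|Y|^3]}{\mathbb{E}^{3/2}[Y^2]}$ for all $y$ and $n$ (it is known that one may take $C_{\mathrm{BE}}<0.4785$).
   Formalization: Θ is taken to be a nonempty open interval instead of an arbitrary subset of ℝ; for disconnected Θ, dη/dθ > 0 does not make η increasing and the first inequalities can fail, and at closed endpoints the moments in (v) may be infinite. *)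

(* Defs.v *)
From HB Require Import structures.
From mathcomp Require Import all_boot all_order all_algebra.
From mathcomp Require Import all_classical all_reals all_analysis.
Set Implicit Arguments. Unset Strict Implicit. Unset Printing Implicit Defensive.
Import Order.TTheory GRing.Theory Num.Theory.
Import numFieldNormedType.Exports.
Local Open Scope classical_set_scope.
Local Open Scope ring_scope.

(** Mutual independence of finitely many real random variables under P:
    the product rule for every choice of measurable sets (taking B i = setT
    recovers every subfamily). Probabilities are finite, hence [fine]. *)
Definition mutually_independent {d} {Om : measurableType d} {R : realType}
  (P : probability Om R) (n : nat) (Y : 'I_n -> Om -> R) : Prop :=
  forall B : 'I_n -> set R, (forall i, measurable (B i)) ->
    fine (P (\bigcap_(i in [set: 'I_n]) (Y i @^-1` B i)))
    = \prod_(i < n) fine (P (Y i @^-1` B i)).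

Definition Phi {R : realType} (y : R) : R :=
  fine (\int[@lebesgue_measure R]_(x in `]-oo, y]) (normal_pdf 0 1 x)%:E)%E.

Definition BE_constant {R : realType} (C : R) : Prop :=
  forall (d : measure_display) (Om : measurableType d) (P : probability Om R)
    (k : nat) (Y : 'I_k.+1 -> Om -> R),
    (forall i, measurable_fun setT (Y i)) ->
    mutually_independent P Y ->
    (forall i j (B : set R), measurable B ->
        P (Y i @^-1` B) = P (Y j @^-1` B)) ->
    P.-integrable setT (fun w => (`|Y ord0 w| ^+ 3)%:E) ->
    ('E_P[Y ord0] = 0)%E ->
    (0 < 'E_P[fun w => (Y ord0 w ^+ 2)%R])%E ->
    forall y : R,
      `| fine (P [set w | (\sum_(i < k.+1) Y i w)
                       / Num.sqrt (k.+1%:R * fine ('E_P[fun w => (Y ord0 w ^+ 2)%R])%E) <= y])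
         - Phi y |
      <= C / Num.sqrt k.+1%:R
         * (fine ('E_P[fun w => (`|Y ord0 w| ^+ 3)%R])%E
            / powR (fine ('E_P[fun w => (Y ord0 w ^+ 2)%R])%E) (3 / 2)).

Definition expfam_density {R : realType} (h T eta A : R -> R) (x theta : R) : R :=
  h x * expR (eta theta * T x - A theta).

Definition sample_mean_T {R : realType} (n : nat) (T : R -> R) (x : 'I_n -> R) : R :=
  (\sum_(i < n) T (x i)) / n%:R.

Definition likelihood {R : realType} (n : nat) (h T eta A : R -> R)
  (x : 'I_n -> R) (theta : R) : R :=
  \prod_(i < n) expfam_density h T eta A (x i) theta.

Definition Mfun {R : realType} (n : nat) (eta A : R -> R) (z theta : R) : R :=
  (expR (eta theta * z - A theta) / expR (eta z * z - A z)) ^+ n.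

Definition abs_moment {R : realType} (mu : {measure set R -> \bar R})
  (h T eta A : R -> R) (k : nat) (z : R) : R :=
  fine (\int[mu]_x ((`|T x - z| ^+ k) * expfam_density h T eta A x z)%:E)%E.

(* Main.v *)
Require Import Defs.
From HB Require Import structures.
From mathcomp Require Import all_boot all_order all_algebra.
From mathcomp Require Import all_classical all_reals all_analysis.
From mathcomp Require Import measurable_realfun ring lra.
Import Order.TTheory GRing.Theory Num.Theory.
Import numFieldNormedType.Exports.
Local Open Scope classical_set_scope.
Local Open Scope ring_scope.

(** Passing from parameter z to parameter th multiplies the law of the sample by
    exp(n((eta th - eta z) thetahat - (A th - A z))), by independence and a
    Dynkin argument on cylinder events. On the tail beyond z this factor is at
    most M(z, th) because eta increases, which gives the tail bounds. The same
    tilt turns E_th exp(nt(thetahat - z)) into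
    M(z, th) E_z exp(n(t - eta z + eta th)(thetahat - z)), which is at least
    M(z, th) by exp x >= 1 + x and E_z thetahat = z.

    The mean of T(X) needs no differentiation under the integral:
    exp x >= 1 + x gives exp(A th - A t) >= 1 + (eta th - eta t) E_t T(X), with
    equality at th = t, so the derivatives in th agree there. Likelihood and
    monotonicity claims follow from d/dth (eta th c - A th) = eta' th (c - th).
    For (v), T(X) is not a.s. constant (that would make th -> eta th z - A th
    constant), so Berry-Esseen applies to +-(T(X_i) - z) at 0, where Phi is 1/2. *)

Set Implicit Arguments.
Unset Strict Implicit.
Unset Printing Implicit Defensive.

(** * Change of measure for independent samples *)

(** Packing a weight as a measure makes pushforwards and uniqueness of measures available for
    weighted integrals. *)
Lemma density_measure_exists d (T : measurableType d) (R : realType)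
    (mu : {measure set T -> \bar R}) (W : T -> R) :
  measurable_fun setT W -> (forall x, 0 <= W x) ->
  exists nu : {measure set T -> \bar R},
    forall A, nu A = (\int[mu]_(x in A) (W x)%:E)%E.
Proof.
move=> mW W0.
pose f (A : set T) : \bar R := (\int[mu]_(x in A) (W x)%:E)%E.
have f0 : f set0 = 0%E by rewrite /f integral_set0.
have fge0 A : (0 <= f A)%E by apply: integral_ge0 => x _; rewrite lee_fin.
have fadd : semi_sigma_additive f.
  move=> F mF tF mUF; rewrite /f ge0_integral_bigcup//=.
  - apply: is_cvg_ereal_nneg_natsum_cond => k _ _; exact: fge0.
  - by apply: (measurable_funS measurableT) => //; exact/measurable_EFinP.
  - by move=> x _; rewrite lee_fin.
pose m := isMeasure.Build d T R f f0 fge0 fadd.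
pose nu : {measure set T -> \bar R} := HB.pack f m.
by exists nu.
Qed.

Section IntegralDensity.
Import HBNNSimple.

(** For indicators this is the hypothesis on [nu]; linearity gives simple functions and monotone
    convergence the rest. Here [mu] may be the counting measure on the reals, which is not
    sigma-finite, so no Radon-Nikodym derivative is invoked. *)
Lemma integral_density d (T : measurableType d) (R : realType)
    (mu nu : {measure set T -> \bar R}) (W g : T -> R) :
  measurable_fun setT W -> (forall x, 0 <= W x) ->
  (forall A, measurable A -> nu A = (\int[mu]_(x in A) (W x)%:E)%E) ->
  measurable_fun setT g -> (forall x, 0 <= g x) ->
  (\int[nu]_x (g x)%:E = \int[mu]_x (g x * W x)%:E)%E.
Proof.
move=> mW W0 nuE mg g0.
have mg' : measurable_fun setT (EFin \o g) by exact/measurable_EFinP.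
pose f_ := nnsfun_approx measurableT mg'.
have f_cvg x : (fun k => (f_ k x)%:E) @ \oo --> (g x)%:E.
  by apply: cvg_nnsfun_approx => // y _; rewrite lee_fin.
have f_meas k : measurable_fun setT (f_ k) by exact: measurable_funP.
have f_ge0 k x : 0 <= f_ k x by [].
have f_nd x : {homo (fun k => f_ k x) : k m / (k <= m)%N >-> k <= m}.
  by move=> k m km; exact/lefP/nd_nnsfun_approx.
transitivity (limn (fun k => \int[nu]_x (f_ k x)%:E))%E.
  rewrite -monotone_convergence//.
  - by apply: eq_integral => x _; apply/esym/cvg_lim => //; exact: f_cvg.
  - by move=> k; exact/measurable_EFinP.
  - by move=> k x _; rewrite lee_fin.
  - by move=> x _ k m km; rewrite lee_fin; exact: f_nd.
transitivity (limn (fun k => \int[mu]_x (f_ k x * W x)%:E))%E; last first.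
  rewrite -monotone_convergence//.
  - apply: eq_integral => x _; apply/cvg_lim => //.
    rewrite EFinM; under eq_fun do rewrite EFinM.
    by apply: cvgeZr => //; exact: f_cvg.
  - by move=> k; apply/measurable_EFinP/measurable_funM.
  - by move=> k x _; rewrite lee_fin mulr_ge0.
  - by move=> x _ k m km; rewrite lee_fin ler_wpM2r//; exact: f_nd.
congr (limn _); apply/funext => k.
have mfk r : measurable (f_ k @^-1` [set r]) by [].
rewrite integralT_nnsfun sintegralE.
(* The simple function is split over its finitely many values, and each level set is measured by
   [nu]. *)
transitivity (\sum_(r \in range (f_ k))
   \int[mu]_x (r%:E * (\1_(f_ k @^-1` [set r]) x * W x)%:E))%E.
  apply: eq_fsbigr => r; rewrite inE => -[x _ <-].
  rewrite ge0_integralZl//.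
  - congr (_ * _)%E; rewrite nuE// [LHS]integral_mkcond.
    apply: eq_integral => y _; rewrite patchE indicE.
    by case: ifPn; rewrite ?mul1r ?mul0r.
  - by apply/measurable_EFinP/measurable_funM => //; exact: measurable_indic.
  - by move=> y _; rewrite lee_fin mulr_ge0.
  - by rewrite lee_fin.
rewrite -ge0_integral_fsum//.
- apply: eq_integral => x _; rewrite fimfunE EFinM -fsumEFin//.
  rewrite ge0_mule_fsuml; last by move=> r; rewrite nnfun_muleindic_ge0.
  by apply: eq_fsbigr => r _; rewrite -!EFinM mulrA.
- move=> r; apply/measurable_EFinP/measurable_funM => //.
  by apply/measurable_funM => //; exact: measurable_indic.
- move=> r x _; rewrite EFinM muleA; apply: mule_ge0; last by rewrite lee_fin.
  exact: nnfun_muleindic_ge0.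
Qed.

End IntegralDensity.

(* Both sides integrate [g] against the image under [Xj] of the measure of density [Wj]. *)
Lemma integral_comp_transfer d1 d2 (T1 : measurableType d1)
    (T2 : measurableType d2) (R : realType)
    (m1 : {measure set T1 -> \bar R}) (m2 : {measure set T2 -> \bar R})
    (X1 : T1 -> R) (X2 : T2 -> R) (W1 : T1 -> R) (W2 : T2 -> R) (g : R -> R) :
  measurable_fun setT X1 -> measurable_fun setT X2 ->
  measurable_fun setT W1 -> measurable_fun setT W2 ->
  (forall x, 0 <= W1 x) -> (forall x, 0 <= W2 x) ->
  (forall B, measurable B -> \int[m1]_(x in X1 @^-1` B) (W1 x)%:E =
                             \int[m2]_(x in X2 @^-1` B) (W2 x)%:E)%E ->
  measurable_fun setT g -> (forall x, 0 <= g x) ->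
  (\int[m1]_x (g (X1 x) * W1 x)%:E = \int[m2]_x (g (X2 x) * W2 x)%:E)%E.
Proof.
move=> mX1 mX2 mW1 mW2 W10 W20 E mg g0.
have [n1 n1E] := density_measure_exists m1 mW1 W10.
have [n2 n2E] := density_measure_exists m2 mW2 W20.
have gX1 : measurable_fun setT (g \o X1) by exact: measurableT_comp.
have gX2 : measurable_fun setT (g \o X2) by exact: measurableT_comp.
rewrite -(integral_density mW1 W10 (fun A _ => n1E A) gX1 (fun x => g0 (X1 x))).
rewrite -(integral_density mW2 W20 (fun A _ => n2E A) gX2 (fun x => g0 (X2 x))).
have mg' : measurable_fun setT (EFin \o g) by exact/measurable_EFinP.
have gp y : y \in [set: R] -> (0 <= (EFin \o g) y)%E by rewrite lee_fin.
pose f1 : {mfun T1 >-> R} := HB.pack X1 (isMeasurableFun.Build _ _ _ _ _ mX1).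
pose f2 : {mfun T2 >-> R} := HB.pack X2 (isMeasurableFun.Build _ _ _ _ _ mX2).
transitivity (\int[pushforward n1 f1]_y (g y)%:E)%E.
  by rewrite (ge0_integral_pushforward mX1 n1 measurableT mg' gp).
transitivity (\int[pushforward n2 f2]_y (g y)%:E)%E; last first.
  by rewrite (ge0_integral_pushforward mX2 n2 measurableT mg' gp).
apply: eq_measure_integral => A mA _.
by have := E _ mA; rewrite -n1E -n2E.
Qed.

(* Induction on the number [k] of factors that are not indicators; freeing one
   factor is [integral_comp_transfer] with the other factors as weight. *)
Lemma expectation_prod_independent d (Om : measurableType d) (R : realType)
    (P : probability Om R) (n : nat) (X : 'I_n -> Om -> R) (g : 'I_n -> R -> R) :
  (forall i, measurable_fun setT (X i)) -> mutually_independent P X ->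
  (forall i, measurable_fun setT (g i)) -> (forall i x, 0 <= g i x) ->
  (forall i, (\int[P]_w (g i (X i w))%:E < +oo)%E) ->
  (\int[P]_w (\prod_(i < n) g i (X i w))%:E =
   (\prod_(i < n) fine (\int[P]_w (g i (X i w))%:E)%E)%:E)%E.
Proof.
move=> mX indX.
suff H k : (k <= n)%N -> forall g : 'I_n -> R -> R,
    (forall i, measurable_fun setT (g i)) -> (forall i x, 0 <= g i x) ->
    (forall i, (\int[P]_w (g i (X i w))%:E < +oo)%E) ->
    (forall i : 'I_n, (k <= i)%N -> exists2 B, measurable B & g i = \1_B) ->
    (\int[P]_w (\prod_(i < n) g i (X i w))%:E =
     (\prod_(i < n) fine (\int[P]_w (g i (X i w))%:E)%E)%:E)%E.
  move=> mg g0 goo; apply: (H n) => // i; by rewrite leqNgt ltn_ord.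
(* With indicators only, the claim is independence itself: the product is the indicator of an
   intersection. *)
elim: k => [_ {}g mg g0 goo gB|k IH kn {}g mg g0 goo gB].
  have /choice[B HB] : forall i, exists B, measurable B /\ g i = \1_B.
    by move=> i; have [B mB ->] := gB i isT; exists B.
  have mXB i : measurable (X i @^-1` B i).
    by rewrite -[X in measurable X]setTI; apply: mX => //; case: (HB i).
  have gE i w : g i (X i w) = \1_(X i @^-1` B i) w.
    by case: (HB i) => _ ->; rewrite !indicE.
  have gI i : (\int[P]_w (g i (X i w))%:E = P (X i @^-1` B i))%E.
    under eq_integral do rewrite gE.
    by rewrite integral_indic// setIT.
  under [in RHS]eq_bigr do rewrite gI.
  rewrite -indX => [|i]; last by case: (HB i).
  have mI : measurable (\bigcap_(i in [set: 'I_n]) (X i @^-1` B i)).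
    by apply: fin_bigcap_measurable.
  rewrite fineK ?fin_num_measure//.
  transitivity (\int[P]_w (\1_(\bigcap_(i in [set: 'I_n]) (X i @^-1` B i)) w)%:E)%E.
    apply: eq_integral => w _; congr (_%:E); rewrite indicE.
    under eq_bigr do rewrite gE indicE.
    have [wI|wI] := boolP (w \in _).
      rewrite big1// => i _; rewrite mem_set//.
      by move: wI; rewrite inE => /(_ i); apply.
    have [i iB] : exists i, ~ (X i @^-1` B i) w.
      apply: contrapT => /forallNP H; move: wI; rewrite notin_setE; apply.
      by move=> i _; apply: contrapT; exact: H.
    by rewrite (bigD1 i)//= memNset// mul0r.
  by rewrite integral_indic// setIT.
pose i0 : 'I_n := Ordinal kn.
pose W w := \prod_(i < n | i != i0) g i (X i w).
pose C := \prod_(i < n | i != i0) fine (\int[P]_w (g i (X i w))%:E)%E.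
have W0 w : 0 <= W w by apply: prodr_ge0.
have C0 : 0 <= C.
  by apply: prodr_ge0 => i _; apply: fine_ge0; apply: integral_ge0 => w _; rewrite lee_fin.
have mgX i : measurable_fun setT (fun w => g i (X i w)) by exact: measurableT_comp.
have mW : measurable_fun setT W.
  rewrite /W; under eq_fun do rewrite -big_filter.
  by apply: measurable_prod => i _.
under eq_integral do rewrite (bigD1 i0)//=.
rewrite [in RHS](bigD1 i0)//=.
(* Seen through [X i0], the weight [W] and the constant [C] have the same image. This is the
   induction hypothesis with factor [i0] replaced by the indicator of [B]. *)
have key B : measurable B ->
    (\int[P]_(x in X i0 @^-1` B) (W x)%:E = \int[P]_(x in X i0 @^-1` B) (cst C x)%:E)%E.
  move=> mB.
  have mXB : measurable (X i0 @^-1` B).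
    by rewrite -[X in measurable X]setTI; apply: mX.
  pose g' i := if i == i0 then \1_B else g i.
  have g'0 : g' i0 = \1_B by rewrite /g' eqxx.
  have g'N i : i != i0 -> g' i = g i by rewrite /g' => /negbTE ->.
  have PB : (\int[P]_w (g' i0 (X i0 w))%:E = P (X i0 @^-1` B))%E.
    transitivity (\int[P]_w (\1_(X i0 @^-1` B) w)%:E)%E.
      by apply: eq_integral => w _; rewrite g'0 !indicE.
    by rewrite integral_indic// setIT.
  transitivity (\int[P]_w (\prod_(i < n) g' i (X i w))%:E)%E.
    rewrite integral_mkcond; apply: eq_integral => w _.
    rewrite (bigD1 i0)//= g'0 patchE indicE.
    rewrite (eq_bigr (fun i => g i (X i w))) => [|i /g'N ->//].
    have -> : (w \in X i0 @^-1` B) = (X i0 w \in B) by apply/idP/idP; rewrite !inE.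
    by case: ifP; rewrite ?mul1r ?mul0r.
  rewrite IH//.
  - rewrite (bigD1 i0)//= PB (eq_bigr (fun i => fine (\int[P]_w (g i (X i w))%:E)%E)).
      by rewrite integral_cst// EFinM fineK ?fin_num_measure// muleC.
    by move=> i /g'N ->.
  - exact: ltnW.
  - by move=> i; rewrite /g'; case: ifP.
  - by move=> i x; rewrite /g'; case: ifP.
  - move=> i; have [->|/g'N ->//] := eqVneq i i0.
    by rewrite PB -ge0_fin_numE// fin_num_measure.
  - move=> i; rewrite leq_eqVlt => /orP[/eqP ki|ki].
      by exists B => //; have -> : i = i0 by apply: val_inj.
    have /g'N -> : i != i0 by rewrite -val_eqE /= gtn_eqF.
    exact: gB.
rewrite (integral_comp_transfer (mX i0) (mX i0) mW (W2 := cst C) _ W0 _ key)//.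
under eq_integral do rewrite EFinM /=.
rewrite ge0_integralZr//=.
- by rewrite EFinM fineK// ge0_fin_numE//; apply: integral_ge0 => w _; rewrite lee_fin.
- exact/measurable_EFinP.
- by move=> w _; rewrite lee_fin.
Qed.

(** This is [integral_comp_transfer] with weight 1 on the sample space and, on the real line, the
    identity with weight [f]. *)
Lemma integral_law d (Om : measurableType d) (R : realType)
    (P : probability Om R) (mu : {measure set R -> \bar R})
    (X : Om -> R) (f g : R -> R) :
  measurable_fun setT X -> measurable_fun setT f -> (forall x, 0 <= f x) ->
  (forall B, measurable B -> P (X @^-1` B) = (\int[mu]_(x in B) (f x)%:E)%E) ->
  measurable_fun setT g -> (forall x, 0 <= g x) ->
  (\int[P]_w (g (X w))%:E = \int[mu]_x (g x * f x)%:E)%E.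
Proof.
move=> mX mf f0 PX mg g0.
have key B : measurable B ->
    (\int[P]_(w in X @^-1` B) (cst 1 w)%:E = \int[mu]_(x in id @^-1` B) (f x)%:E)%E.
  move=> mB; rewrite preimage_id -PX//= integral_cst ?mul1e//.
  by rewrite -[X in measurable X]setTI; exact: mX.
rewrite -(integral_comp_transfer mX (@measurable_id _ _ _) (W1 := cst 1) _ mf _ f0 key)//.
by apply: eq_integral => w _; rewrite /= mulr1.
Qed.

(** A pi-system generating the sigma-algebra of the sample; independence determines a probability on
    it. *)
Definition cylinders d (Om : measurableType d) (R : realType) (n : nat)
    (X : 'I_n -> Om -> R) : set (set Om) :=
  [set E | exists2 B : 'I_n -> set R, (forall i, measurable (B i)) &
     E = \bigcap_(i in [set: 'I_n]) (X i @^-1` B i)].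

Lemma sum_preimage_cylinders d (Om : measurableType d) (R : realType) (n : nat)
    (X : 'I_n -> Om -> R) (f : R -> R) (B : set R) :
  measurable_fun setT f -> measurable B ->
  <<s cylinders X >> ((fun w => \sum_(i < n) f (X i w)) @^-1` B).
Proof.
move=> mf mB.
have mX i : measurable_fun (T := g_sigma_algebraType (cylinders X)) setT (X i).
  move=> _ C mC; rewrite setTI; apply: sub_sigma_algebra.
  (* A condition on one coordinate is a cylinder whose other sides are the whole line. *)
  exists (fun j => if j == i then C else setT); first by move=> j; case: ifP.
  apply/seteqP; split => w /=.
    by move=> Cw j _; case: eqP => // ->.
  by move=> /(_ i Logic.I); rewrite eqxx.
have : measurable_fun (T := g_sigma_algebraType (cylinders X)) setT
    (fun w => \sum_(i < n) f (X i w)).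
  by apply: measurable_sum => i; exact: (measurableT_comp mf (mX i)).
by move=> /(_ measurableT B mB); rewrite setTI.
Qed.

(** Both sides are measures that agree on cylinders, where independence under [P] and [Q] factorises
    them, hence on the generated sigma-algebra. On events not determined by the sample, [P] and [Q]
    may be unrelated. *)
Lemma independent_change_of_measure d (Om : measurableType d) (R : realType)
    (P Q : probability Om R) (n : nat) (X : 'I_n -> Om -> R) (l : R -> R) :
  (forall i, measurable_fun setT (X i)) ->
  mutually_independent P X -> mutually_independent Q X ->
  measurable_fun setT l -> (forall x, 0 <= l x) ->
  (forall i B, measurable B ->
     Q (X i @^-1` B) = (\int[P]_(w in X i @^-1` B) (l (X i w))%:E)%E) ->
  forall E, <<s cylinders X >> E ->
    Q E = (\int[P]_(w in E) (\prod_(i < n) l (X i w))%:E)%E.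
Proof.
move=> mX indP indQ ml l0 Ql.
have mlX i : measurable_fun setT (fun w => l (X i w)) by exact: measurableT_comp.
have mL : measurable_fun setT (fun w => \prod_(i < n) l (X i w)).
  by apply: measurable_prod => i _.
have L0 w : 0 <= \prod_(i < n) l (X i w) by apply: prodr_ge0.
have mXB i B : measurable B -> measurable (X i @^-1` B).
  by move=> mB; rewrite -[X in measurable X]setTI; exact: mX.
have [nu nuE] := density_measure_exists P mL L0.
have QC E : cylinders X E -> Q E = nu E.
  move=> [B mB ->]; rewrite nuE integral_mkcond.
  have mC : measurable (\bigcap_(i in [set: 'I_n]) (X i @^-1` B i)).
    by apply: fin_bigcap_measurable => // i _; exact: mXB.
  (* Absorbing the side [B i] into the factor turns the integral over a cylinder into an integral of
     a product. *)
  pose g i x := l x * \1_(B i) x.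
  have gI i : (\int[P]_w (g i (X i w))%:E = Q (X i @^-1` B i))%E.
    rewrite Ql// [RHS]integral_mkcond; apply: eq_integral => w _.
    rewrite patchE /g indicE.
    have -> : (w \in X i @^-1` B i) = (X i w \in B i) by apply/idP/idP; rewrite !inE.
    by case: ifP; rewrite ?mulr1 ?mulr0.
  transitivity (\int[P]_w (\prod_(i < n) g i (X i w))%:E)%E.
    rewrite expectation_prod_independent//.
    + under eq_bigr do rewrite gI.
      by rewrite -indQ// fineK// fin_num_measure.
    + by move=> i; apply: measurable_funM => //; exact: measurable_indic.
    + by move=> i x; rewrite mulr_ge0.
    + by move=> i; rewrite gI -ge0_fin_numE// fin_num_measure//; exact: mXB.
  apply: eq_integral => w _; rewrite patchE.
  have [wI|wI] := boolP (w \in _).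
    congr (_%:E); apply: eq_bigr => i _; rewrite /g indicE mem_set ?mulr1//.
    by move: wI; rewrite inE => /(_ i); apply.
  have [i iB] : exists i, ~ (X i @^-1` B i) w.
    apply: contrapT => /forallNP H; move: wI; rewrite notin_setE; apply.
    by move=> i _; apply: contrapT; exact: H.
  by rewrite (bigD1 i)//= /g indicE memNset// mulr0 mul0r.
have CT : cylinders X setT.
  by exists (fun=> setT) => //; apply/esym/seteqP; split.
have Cm : cylinders X `<=` measurable.
  by move=> E [B mB ->]; apply: fin_bigcap_measurable => // i _; exact: mXB.
have CI : setI_closed (cylinders X).
  move=> E F [B mB ->] [C mC ->]; exists (fun i => B i `&` C i).
    by move=> i; exact: measurableI.
  rewrite -bigcapI; apply: eq_bigcapr => i _; exact: preimage_setI.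
have HE : [set E | cylinders X E /\ E `<=` setT] = cylinders X.
  by apply/seteqP; split => [E []|E CE //].
move=> E sE; rewrite -nuE.
apply: (g_sigma_algebra_measure_unique_trace (cylinders X) setT) => //; rewrite ?HE//.
- exact: QC.
- by rewrite -ge0_fin_numE// fin_num_measure.
Qed.

(** * The functions [eta] and [A] *)

Lemma is_interval_itvcc (R : realType) (Theta : set R) (a b x : R) :
  is_interval Theta -> Theta a -> Theta b -> a <= x <= b -> Theta x.
Proof. by move=> iT Ta Tb /andP[ax xb]; apply: (iT a b) => //; rewrite ax xb. Qed.

Lemma interval_MVT (R : realType) (Theta : set R) (f : R -> R) (a b : R) :
  is_interval Theta -> (forall x, Theta x -> derivable f x 1) ->
  Theta a -> Theta b -> a < b ->
  exists2 c, a < c < b & f b - f a = derive1 f c * (b - a).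
Proof.
move=> iT df Ta Tb ab.
have Tab x : x \in `[a, b] -> Theta x.
  by rewrite in_itv/= => /(is_interval_itvcc iT Ta Tb).
have [c cab E] : exists2 c, c \in `]a, b[%R & f b - f a = derive1 f c * (b - a).
  apply: MVT => //.
  - move=> x xab; have /df/derivableP : Theta x.
      by apply: Tab; move: xab; exact: subset_itv_oo_cc.
    by rewrite derive1E.
  - apply: derivable_within_continuous => x xab; apply: df; exact: Tab.
by exists c; rewrite // -[_ < _ < _]/(c \in `]a, b[%R).
Qed.

Section ExponentialFamilyParameters.
Variables (R : realType) (Theta : set R) (eta A : R -> R).
Hypothesis iT : is_interval Theta.
Hypothesis dT : forall th, Theta th -> derivable eta th 1 /\ derivable A th 1.
Hypothesis eta'_gt0 : forall th, Theta th -> 0 < derive1 eta th.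

Lemma eta_lt a b : Theta a -> Theta b -> a < b -> eta a < eta b.
Proof.
move=> Ta Tb ab.
have [c /andP[ac cb] E] := interval_MVT iT (fun x Tx => (dT Tx).1) Ta Tb ab.
rewrite -subr_gt0 E mulr_gt0 ?subr_gt0// eta'_gt0//.
by apply: (is_interval_itvcc iT Ta Tb); rewrite !ltW.
Qed.

Lemma eta_le a b : Theta a -> Theta b -> a <= b -> eta a <= eta b.
Proof.
move=> Ta Tb; rewrite le_eqVlt => /orP[/eqP ->//|ab].
exact/ltW/eta_lt.
Qed.

Hypothesis A'E : forall th, Theta th -> derive1 A th = th * derive1 eta th.

(* The derivative in [th] of [eta th * c - A th] is [eta' th * (c - th)]. *)
Lemma loglik_MVT c a b : Theta a -> Theta b -> a < b ->
  exists2 x, a < x < b & exists2 y, 0 < y &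
    (eta b * c - A b) - (eta a * c - A a) = y * (c - x).
Proof.
move=> Ta Tb ab.
have D x : Theta x -> is_derive x 1 (fun t => eta t * c - A t)
    (derive1 eta x * (c - x)).
  move=> Tx; have [/derivableP d1 /derivableP d2] := dT Tx.
  apply: is_derive_eq.
  by rewrite -!derive1E A'E// scaler0 add0r /GRing.scale/=; ring.
have Dd x : Theta x -> derivable (fun t => eta t * c - A t) x 1.
  by move=> Tx; have := D x Tx; case.
have [x /andP[ax xb] E] := interval_MVT iT Dd Ta Tb ab.
have Tx : Theta x by apply: (is_interval_itvcc iT Ta Tb); rewrite !ltW.
exists x; first by rewrite ax xb.
exists (derive1 eta x * (b - a)); first by rewrite mulr_gt0 ?subr_gt0 ?eta'_gt0.
rewrite E derive1E; have -> := @derive_val _ _ _ _ _ _ _ (D x Tx).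
by rewrite mulrAC.
Qed.

Lemma loglik_increasing c a b : Theta a -> Theta b -> a < b -> b <= c ->
  eta a * c - A a < eta b * c - A b.
Proof.
move=> Ta Tb ab bc; rewrite -subr_gt0.
have [x /andP[ax xb] [y y0 ->]] := loglik_MVT c Ta Tb ab.
by rewrite mulr_gt0// subr_gt0 (lt_le_trans xb).
Qed.

Lemma loglik_decreasing c a b : Theta a -> Theta b -> a < b -> c <= a ->
  eta b * c - A b < eta a * c - A a.
Proof.
move=> Ta Tb ab ca; rewrite -subr_lt0.
have [x /andP[ax xb] [y y0 ->]] := loglik_MVT c Ta Tb ab.
by rewrite pmulr_rlt0// subr_lt0 (le_lt_trans ca).
Qed.

(** Strictness is what later excludes a degenerate statistic. *)
Lemma loglik_lt_max c a : Theta a -> Theta c -> a != c ->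
  eta a * c - A a < eta c * c - A c.
Proof.
move=> Ta Tc; rewrite neq_lt => /orP[ac|ca].
  exact: loglik_increasing.
exact: loglik_decreasing.
Qed.

Lemma loglik_le_max c a : Theta a -> Theta c ->
  eta a * c - A a <= eta c * c - A c.
Proof.
by move=> Ta Tc; have [->//|ac] := eqVneq a c; exact/ltW/loglik_lt_max.
Qed.

(* The difference of the two sides of the hypothesis is minimal, with value 0, at [t]. *)
Lemma stationary_mean (m t : R) : open Theta -> Theta t ->
  (forall th, Theta th -> 1 + (eta th - eta t) * m <= expR (A th - A t)) ->
  m = t.
Proof.
move=> oT Tt H.
have [a [b [ta tb Tab]]] : exists a b, [/\ a < t, t < b &
    forall x, x \in `]a, b[%R -> Theta x].
  (* [He] concerns balls of radius below [e], so [e / 2] is used as radius and [e / 4] keeps the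
     endpoints strictly inside. *)
  have [e /= e0 He] := open_subball oT Tt.
  exists (t - e / 2 / 2), (t + e / 2 / 2); split => [||x]; try lra.
  rewrite in_itv/= => xab; apply: (He (e / 2)) => /=; try lra.
    by rewrite /ball /= sub0r normrN gtr0_norm; lra.
  by rewrite /ball /= ltr_norml; lra.
pose f th := expR (A th - A t) - (1 + (eta th - eta t) * m).
have D x : Theta x ->
    is_derive x 1 f (derive1 A x * expR (A x - A t) - derive1 eta x * m).
  move=> Tx; have [/derivableP d1 /derivableP d2] := dT Tx.
  apply: is_derive_eq.
  by rewrite -!derive1E !subr0 scaler0 !add0r /GRing.scale/=; ring.
have := derive1_at_min (ltW (lt_trans ta tb)) (f := f) (c := t).
move=> /(_ _ _ _)[].
- by move=> x /Tab /D[].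
- by rewrite in_itv/= ta tb.
- move=> x /Tab Tx; rewrite /f !subrr mul0r addr0 expR0 subrr subr_ge0; exact: H.
move=> _ E; have := @derive_val _ _ _ _ _ _ _ (D t Tt).
(* The vanishing derivative at [t] reads [derive1 eta t * (t - m) = 0]. *)
rewrite E subrr expR0 mulr1 A'E// => /esym/eqP.
rewrite [t * _]mulrC -mulrBr mulf_eq0 gt_eqF/= ?eta'_gt0// subr_eq0.
by move=> /eqP.
Qed.

End ExponentialFamilyParameters.

(** * Moments *)

(** Raise [x <= expR x], taken at [x = a * y / k.+1%:R], to the power [k.+1]. *)
Lemma expr_le_expR (R : realType) (a y : R) (k : nat) : 0 < a -> 0 <= y ->
  y ^+ k.+1 <= (k.+1%:R / a) ^+ k.+1 * expR (a * y).
Proof.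
move=> a0 y0; have k0 : 0 < k.+1%:R :> R by rewrite ltr0n.
have H : y <= k.+1%:R / a * expR (a * y / k.+1%:R).
  rewrite -ler_pdivrMl ?divr_gt0// invf_div.
  rewrite [leLHS](_ : _ = a * y / k.+1%:R); last by rewrite mulrAC.
  by apply: le_trans (expR_ge1Dx _); rewrite lerDr.
rewrite -(divfK (lt0r_neq0 k0) (a * y)) expRM_natr -exprMn.
by rewrite lerXn2r// nnegrE; exact: le_trans H.
Qed.

(** One exponential dominates the power where [Y] is nonnegative, the other where it is negative;
    their sum dominates everywhere. *)
Lemma integrable_expr_of_expR d (Om : measurableType d) (R : realType)
    (P : probability Om R) (Y : Om -> R) (a b : R) (k : nat) :
  measurable_fun setT Y -> 0 < a -> 0 < b ->
  (\int[P]_w (expR (a * Y w))%:E < +oo)%E ->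
  (\int[P]_w (expR (- b * Y w))%:E < +oo)%E ->
  P.-integrable setT (fun w => (`|Y w| ^+ k.+1)%:E).
Proof.
move=> mY a0 b0 fa fb.
have mE c : measurable_fun setT (fun w => expR (c * Y w)).
  by apply: measurableT_comp => //; exact: measurable_funM.
have iE c : (\int[P]_w (expR (c * Y w))%:E < +oo)%E ->
    P.-integrable setT (fun w => (expR (c * Y w))%:E).
  move=> fc; apply/integrableP; split; first exact/measurable_EFinP.
  by under eq_integral do rewrite /= ger0_norm ?expR_ge0//.
pose Ca := (k.+1%:R / a) ^+ k.+1; pose Cb := (k.+1%:R / b) ^+ k.+1.
have Ca0 : 0 <= Ca by rewrite exprn_ge0// divr_ge0// ltW.
have Cb0 : 0 <= Cb by rewrite exprn_ge0// divr_ge0// ltW.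
have iS := integrableD measurableT (integrableZl measurableT Ca (iE _ fa))
  (integrableZl measurableT Cb (iE _ fb)).
apply: le_integrable iS => //.
  apply/measurable_EFinP/measurable_funX; exact: measurableT_comp.
move=> w _ /=; rewrite lee_fin normrX normr_id [leRHS]ger0_norm; last first.
  by rewrite addr_ge0 ?mulr_ge0 ?expR_ge0.
have [y0|y0] := leP 0 (Y w).
  rewrite ger0_norm//; apply: le_trans (expr_le_expR _ a0 y0) _.
  by rewrite lerDl mulr_ge0 ?expR_ge0.
rewrite ltr0_norm//; apply: (@le_trans _ _ (Cb * expR (b * - Y w))).
  by apply: expr_le_expR => //; rewrite oppr_ge0 ltW.
by rewrite mulrN -mulNr lerDr mulr_ge0 ?expR_ge0.
Qed.

(* Young's inequality [4 a^3 c <= 3 a^4 + c^4] integrated at [c = m4 ^ (1/4)]. *)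
Lemma third_moment_le d (Om : measurableType d) (R : realType)
    (P : probability Om R) (Y : Om -> R) :
  P.-integrable setT (fun w => (`|Y w| ^+ 3)%:E) ->
  P.-integrable setT (fun w => (`|Y w| ^+ 4)%:E) ->
  0 < fine (\int[P]_w (`|Y w| ^+ 4)%:E)%E ->
  fine (\int[P]_w (`|Y w| ^+ 3)%:E)%E <=
    powR (fine (\int[P]_w (`|Y w| ^+ 4)%:E)%E) (3 / 4).
Proof.
move=> i3 i4; set m4 := fine _; set m3 := fine _ => m40.
pose c := powR m4 (1 / 4).
have c0 : 0 < c by exact: powR_gt0.
have c4 : c ^+ 4 = m4.
  rewrite -powR_mulrn ?ltW// -powRrM.
  have -> : 1 / 4 * 4%:R = 1 :> R by field.
  by rewrite powRr1// ltW.
have -> : powR m4 (3 / 4) = c ^+ 3.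
  by rewrite -powR_mulrn ?ltW// -powRrM; congr powR; field.
have m3E : (\int[P]_w (`|Y w| ^+ 3)%:E = m3%:E)%E.
  by rewrite fineK//; exact: integrable_fin_num.
have m4E : (\int[P]_w (`|Y w| ^+ 4)%:E = m4%:E)%E.
  by rewrite fineK//; exact: integrable_fin_num.
have ic : P.-integrable setT (fun=> (c ^+ 4)%:E).
  exact: finite_measure_integrable_cst.
(* Since [c ^+ 4 = m4], this says [4 * c * m3 <= 4 * c ^+ 4], that is [m3 <= c ^+ 3]. *)
have H : ((4 * c)%:E * \int[P]_w (`|Y w| ^+ 3)%:E <=
    3%:E * \int[P]_w (`|Y w| ^+ 4)%:E + \int[P]_w (c ^+ 4)%:E)%E.
  rewrite -!integralZl// -integralD//; last exact: integrableZl.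
  apply: le_integral => //.
  - exact: integrableZl.
  - by apply: integrableD => //; exact: integrableZl.
  move=> w _; rewrite -!EFinM -EFinD lee_fin; set y := `|Y w|.
  have y0 : 0 <= y by exact: normr_ge0.
  rewrite -subr_ge0.
  have -> : 3 * y ^+ 4 + c ^+ 4 - 4 * c * y ^+ 3 =
    (y - c) ^+ 2 * (3 * y ^+ 2 + 2 * y * c + c ^+ 2) by ring.
  by rewrite mulr_ge0 ?sqr_ge0// !addr_ge0// ?mulr_ge0 ?sqr_ge0// ltW.
move: H; rewrite m3E m4E integral_cst//= probability_setT mule1 -!EFinM -EFinD lee_fin -c4.
have -> : 3 * c ^+ 4 + c ^+ 4 = 4 * c * c ^+ 3 by ring.
by rewrite ler_pM2l// mulr_gt0.
Qed.

Lemma integral_pow_eq0 d (Om : measurableType d) (R : realType)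
    (P : probability Om R) (Y : Om -> R) (k : nat) :
  measurable_fun setT Y ->
  (\int[P]_w (`|Y w| ^+ k.+1)%:E = 0)%E ->
  ae_eq P setT Y (cst 0).
Proof.
move=> mY I0.
pose f w := `|Y w| ^+ k.+1.
have mk : measurable_fun setT (EFin \o f).
  apply/measurable_EFinP/measurable_funX; exact: measurableT_comp.
have : (\int[P]_w `|(EFin \o f) w| = 0)%E.
  by rewrite -[RHS]I0; apply: eq_integral => w _ /=; rewrite ger0_norm// exprn_ge0.
move=> /(ae_eq_integral_abs P measurableT mk).
apply: filterS => w /(_ Logic.I) /= [] /eqP E _.
by move: E; rewrite expf_eq0/= normr_eq0 => /eqP.
Qed.

(** * Moments of a statistic with exponential-family exponential moments *)

Section NaturalStatistic.
Variables (R : realType) (Theta : set R) (eta A : R -> R).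
Hypothesis iT : is_interval Theta.
Hypothesis oT : open Theta.
Hypothesis dT : forall th, Theta th -> derivable eta th 1 /\ derivable A th 1.
Hypothesis eta'_gt0 : forall th, Theta th -> 0 < derive1 eta th.
Hypothesis A'E : forall th, Theta th -> derive1 A th = th * derive1 eta th.
Variables (d : measure_display) (Om : measurableType d) (P : probability Om R).
Variables (Y : Om -> R) (t : R).
Hypothesis mY : measurable_fun setT Y.
Hypothesis Tt : Theta t.
Hypothesis mgfY : forall th, Theta th ->
  (\int[P]_w (expR ((eta th - eta t) * Y w))%:E = (expR (A th - A t))%:E)%E.

Lemma open_neighbours : exists a b, [/\ Theta a, Theta b, a < t & t < b].
Proof.
have [e /= e0 He] := open_subball oT Tt.
exists (t - e / 2 / 2), (t + e / 2 / 2); split; try lra;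
  apply: (He (e / 2)) => /=; rewrite /ball_ ?/ball /=; try lra;
  by rewrite ?sub0r ?normrN ltr_norml; lra.
Qed.

(** Parameters on both sides of [t] give finite exponential moments with exponents of both signs,
    because [eta] increases; centring at [c] only multiplies them by constants. *)
Lemma integrable_statistic_pow (c : R) k :
  P.-integrable setT (fun w => (`|Y w - c| ^+ k.+1)%:E).
Proof.
have [a [b [Ta Tb ta tb]]] := open_neighbours.
have fin th : Theta th -> (\int[P]_w (expR ((eta th - eta t) * (Y w - c)))%:E < +oo)%E.
  move=> Tth; under eq_integral do rewrite mulrBr expRD mulrC EFinM.
  rewrite ge0_integralZl//; first by rewrite mgfY// -EFinM ltry.
  - apply/measurable_EFinP/measurableT_comp => //; exact: measurable_funM.
pose Z w := Y w - c.
apply: (@integrable_expr_of_expR _ _ _ P Z (eta b - eta t) (eta t - eta a)).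
- exact: measurable_funB.
- by rewrite subr_gt0; exact: (eta_lt iT dT).
- by rewrite subr_gt0; exact: (eta_lt iT dT).
- exact: fin.
- rewrite opprB; exact: fin.
Qed.

Lemma integrable_statistic : P.-integrable setT (EFin \o Y).
Proof.
have := integrable_statistic_pow 0 0.
under eq_fun do rewrite subr0 expr1.
move=> iY; apply: le_integrable iY => //; first exact/measurable_EFinP.
by move=> w _ /=; rewrite normr_id.
Qed.

(** Integrating [1 + x <= expR x] at [x = (eta th - eta t) * Y w] gives exactly the inequality that
    [stationary_mean] asks for. *)
Lemma mean_statistic : (\int[P]_w (Y w)%:E = t%:E)%E.
Proof.
have iY := integrable_statistic.
have fY : (\int[P]_w (Y w)%:E \is a fin_num)%E by exact: integrable_fin_num.
rewrite -(fineK fY); congr (_%:E).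
apply: (stationary_mean dT eta'_gt0 A'E oT Tt) => th Tth.
rewrite -lee_fin -mgfY// EFinD EFinM fineK//.
have i1 : P.-integrable setT (fun=> 1%:E) by exact: finite_measure_integrable_cst.
have -> : (1%:E + (eta th - eta t)%:E * \int[P]_w (Y w)%:E =
    \int[P]_w (1 + (eta th - eta t) * Y w)%:E)%E.
  under [RHS]eq_integral do rewrite EFinD EFinM.
  rewrite integralD//; last exact: integrableZl.
  by rewrite integralZl// integral_cst//= probability_setT mule1.
apply: le_integral => //.
- under eq_fun do rewrite EFinD EFinM.
  by apply: integrableD => //; exact: integrableZl.
- apply/integrableP; split.
    apply/measurable_EFinP/measurableT_comp => //; exact: measurable_funM.
  under eq_integral do rewrite /= ger0_norm ?expR_ge0//.
  by rewrite mgfY// ltry.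
- by move=> w _; rewrite lee_fin expR_ge1Dx.
Qed.

(** Otherwise the exponential moment at some [a < t] would give [eta a * t - A a = eta t * t - A t],
    against the strict maximum at [t]. *)
Lemma statistic_not_ae_constant : ~ ae_eq P setT (fun w => Y w - t) (cst 0).
Proof.
move=> H; have [a [_ [Ta _ ta _]]] := open_neighbours.
have := mgfY Ta; rewrite (ae_eq_integral (cst (expR ((eta a - eta t) * t))%:E))//.
- rewrite integral_cst//= probability_setT mule1 => -[] /expR_inj E.
  have := loglik_lt_max iT dT eta'_gt0 A'E Ta Tt (negbT (lt_eqF ta)).
  by move: E; rewrite mulrBl; lra.
- apply/measurable_EFinP/measurableT_comp => //; exact: measurable_funM.
- apply: filterS H => w /(_ Logic.I) /= /eqP; rewrite subr_eq0 => /eqP -> //.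
Qed.

Lemma central_moment_gt0 k : 0 < fine (\int[P]_w (`|Y w - t| ^+ k.+1)%:E)%E.
Proof.
rewrite lt_neqAle fine_ge0 ?andbT; last first.
  by apply: integral_ge0 => w _; rewrite lee_fin exprn_ge0.
apply/eqP => I0; apply: statistic_not_ae_constant.
apply: (@integral_pow_eq0 _ _ _ _ _ k); first exact: measurable_funB.
rewrite -[LHS]fineK -?I0//.
by apply: integrable_fin_num => //; exact: integrable_statistic_pow.
Qed.

End NaturalStatistic.

(** The density is even with total mass 1, so the integral over the negative half-line is half of
    it. *)
Lemma Phi0 (R : realType) : Phi (0 : R) = 1 / 2.
Proof.
have pdfN (x : R) : normal_pdf 0 1 x = normal_pdf 0 1 (- x).
  by rewrite !normal_pdfE ?oner_eq0// /normal_fun !subr0 sqrrN.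
have mp : measurable_fun setT (fun x : R => normal_pdf 0 1 x).
  exact: measurable_normal_pdf.
have H := ge0_symfun_integralT (@normal_pdf_ge0 R 0 1)
  (@continuous_normal_pdf R 0 1 (oner_neq0 _)) pdfN.
rewrite integral_normal_pdf -set_itvcy in H.
rewrite (ge0_integration_by_substitution0 (f := fun x : R => (normal_pdf 0 1 x)%:E)) in H.
- rewrite /Phi; move: H; under eq_integral do rewrite -pdfN.
  (* An infinite half would make the total mass infinite instead of 1. *)
  set I := (\int[_]_(x in _) _)%E; case: I => [r| |]//=.
    by rewrite -EFinM => -[E]; lra.
  + by rewrite mulr_infty/= gtr0_sg// mul1e.
  + by rewrite mulr_infty/= gtr0_sg// mul1e.
- exact/measurable_EFinP.
- by move=> r; rewrite lee_fin normal_pdf_ge0.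
Qed.

(** * The sample mean of [T] *)

Lemma MfunE (R : realType) (n : nat) (eta A : R -> R) (z th : R) :
  Mfun n eta A z th =
  expR (n%:R * ((eta th * z - A th) - (eta z * z - A z))).
Proof. by rewrite /Mfun -expRB expRM_natl. Qed.

(** The parameter enters only through [eta th * c - A th] at the sample mean [c], which reduces
    maximum likelihood to [loglik_le_max]. *)
Lemma likelihoodE (R : realType) (n : nat) (h T eta A : R -> R)
    (x : 'I_n -> R) (th : R) : (0 < n)%N ->
  likelihood h T eta A x th = (\prod_(i < n) h (x i)) *
    expR (n%:R * (eta th * sample_mean_T T x - A th)).
Proof.
move=> n0; rewrite /likelihood /expfam_density big_split/= -expR_sum.
congr (_ * expR _); rewrite big_split/= -mulr_sumr sumr_const card_ord /sample_mean_T.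
by rewrite -mulr_natl; field; rewrite pnatr_eq0 -lt0n.
Qed.

Lemma Mfun_unimodal_param (R : realType) (Theta : set R) (eta A : R -> R) (n : nat) :
  is_interval Theta ->
  (forall th, Theta th -> derivable eta th 1 /\ derivable A th 1) ->
  (forall th, Theta th -> 0 < derive1 eta th) ->
  (forall th, Theta th -> derive1 A th = th * derive1 eta th) ->
  forall z, Theta z ->
      (forall th1 th2, Theta th1 -> Theta th2 -> th1 <= th2 -> th2 <= z ->
         Mfun n eta A z th1 <= Mfun n eta A z th2) /\
      (forall th1 th2, Theta th1 -> Theta th2 -> z <= th1 -> th1 <= th2 ->
         Mfun n eta A z th2 <= Mfun n eta A z th1).
Proof.
move=> iT dT e0 AE z Tz; split => a b Ta Tb.
  rewrite le_eqVlt => /orP[/eqP ->//|ab bz].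
  rewrite !MfunE ler_expR ler_wpM2l// lerD2r ltW//.
  exact: (loglik_increasing iT dT).
move=> za; rewrite le_eqVlt => /orP[/eqP ->//|ab].
rewrite !MfunE ler_expR ler_wpM2l// lerD2r ltW//.
exact: (loglik_decreasing iT dT).
Qed.

(** Put [phi c = eta c * c - A c]. For [a <= b], maximality in [loglik_le_max] places
    [phi b - phi a] between [eta a * (b - a)] and [eta b * (b - a)]. Up to the factor [n], the
    exponent of M changes by [eta th * (b - a) - (phi b - phi a)], whose sign then follows from the
    monotonicity of [eta]. *)
Lemma Mfun_unimodal_point (R : realType) (Theta : set R) (eta A : R -> R) (n : nat) :
  is_interval Theta ->
  (forall th, Theta th -> derivable eta th 1 /\ derivable A th 1) ->
  (forall th, Theta th -> 0 < derive1 eta th) ->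
  (forall th, Theta th -> derive1 A th = th * derive1 eta th) ->
  forall th, Theta th ->
      (forall z1 z2, Theta z1 -> Theta z2 -> z1 <= z2 -> z2 <= th ->
         Mfun n eta A z1 th <= Mfun n eta A z2 th) /\
      (forall z1 z2, Theta z1 -> Theta z2 -> th <= z1 -> z1 <= z2 ->
         Mfun n eta A z2 th <= Mfun n eta A z1 th).
Proof.
move=> iT dT e0 AE th Tth; split => a b Ta Tb.
  move=> ab bth; rewrite !MfunE ler_expR ler_wpM2l//.
  have := loglik_le_max iT dT e0 AE Tb Ta.
  have := eta_le iT dT e0 Tb Tth bth; nra.
move=> tha ab; rewrite !MfunE ler_expR ler_wpM2l//.
have := loglik_le_max iT dT e0 AE Ta Tb.
have := eta_le iT dT e0 Tth Ta tha; nra.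
Qed.

(** * Change of parameter for the sample, and the tail bounds *)

Section IIDSample.
Variables (R : realType) (Theta : set R) (h T eta A : R -> R).
Variables (mu : {measure set R -> \bar R}).
Variables (d : measure_display) (Om : measurableType d) (P : R -> probability Om R).
Variables (k : nat) (X : 'I_k.+1 -> Om -> R).
Local Notation n := k.+1.
Hypothesis iT : is_interval Theta.
Hypothesis oT : open Theta.
Hypothesis mh : measurable_fun setT h.
Hypothesis h0 : forall x, 0 <= h x.
Hypothesis mT : measurable_fun setT T.
Hypothesis dT : forall th, Theta th -> derivable eta th 1 /\ derivable A th 1.
Hypothesis mX : forall i, measurable_fun setT (X i).
Hypothesis indX : forall th, Theta th -> mutually_independent (P th) X.
Hypothesis lawX : forall th i (B : set R), Theta th -> measurable B ->
  P th (X i @^-1` B) = (\int[mu]_(x in B) (expfam_density h T eta A x th)%:E)%E.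
Hypothesis eta'_gt0 : forall th, Theta th -> 0 < derive1 eta th.

Let thetahat := fun w => sample_mean_T T (fun i => X i w).

Let n0 : 0 < n%:R :> R. Proof. by rewrite ltr0n. Qed.

Lemma measurable_expfam_density th :
  measurable_fun setT (fun x => expfam_density h T eta A x th).
Proof.
apply: measurable_funM => //; apply: measurableT_comp => //.
by apply: measurable_funB => //; exact: measurable_funM.
Qed.

Lemma expfam_density_ge0 th x : 0 <= expfam_density h T eta A x th.
Proof. by rewrite mulr_ge0 ?expR_ge0. Qed.

Lemma measurable_TX i : measurable_fun setT (fun w => T (X i w)).
Proof. exact: measurableT_comp. Qed.

Lemma measurable_thetahat : measurable_fun setT thetahat.
Proof.
apply: measurable_funM => //; apply: measurable_sum => i; exact: measurable_TX.
Qed.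

Lemma integral_sample th i (g : R -> R) : Theta th ->
  measurable_fun setT g -> (forall x, 0 <= g x) ->
  (\int[P th]_w (g (X i w))%:E =
   \int[mu]_x (g x * expfam_density h T eta A x th)%:E)%E.
Proof.
move=> Tth mg g0; apply: integral_law => //.
- exact: measurable_expfam_density.
- exact: expfam_density_ge0.
- by move=> B mB; exact: lawX.
Qed.

(** The likelihood ratio of one observation does not involve [h], so no division by a vanishing
    density occurs. *)
Lemma sample_tilt th z i B : Theta th -> Theta z -> measurable B ->
  P th (X i @^-1` B) = (\int[P z]_(w in X i @^-1` B)
    (expR ((eta th - eta z) * T (X i w) - (A th - A z)))%:E)%E.
Proof.
move=> Tth Tz mB; rewrite lawX//.
pose l x := expR ((eta th - eta z) * T x - (A th - A z)).
have ml : measurable_fun setT l.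
  apply: measurableT_comp => //; apply: measurable_funB => //.
  exact: measurable_funM.
have E := @integral_sample z i (fun x => l x * \1_B x) Tz _ _.
transitivity (\int[P z]_w (l (X i w) * \1_B (X i w))%:E)%E.
  rewrite E.
  - rewrite integral_mkcond; apply: eq_integral => x _.
    rewrite patchE indicE; case: ifP => _; last by rewrite mulr0 mul0r.
    rewrite mulr1 /expfam_density /l mulrCA -expRD.
    by congr (_ * expR _)%:E; ring.
  - by apply: measurable_funM => //; exact: measurable_indic.
  - by move=> x; rewrite mulr_ge0 ?expR_ge0.
rewrite [RHS]integral_mkcond; apply: eq_integral => w _.
rewrite patchE indicE.
have -> : (w \in X i @^-1` B) = (X i w \in B) by apply/idP/idP; rewrite !inE.
by case: ifP; rewrite ?mulr1 ?mulr0.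
Qed.

(** The likelihood ratio of the whole sample, as a function of the value [x] of the sample mean. *)
Let L th z x := expR (n%:R * ((eta th - eta z) * x - (A th - A z))).

Let measurable_L th z : measurable_fun setT (L th z).
Proof.
apply: measurableT_comp => //; apply: measurable_funM => //.
by apply: measurable_funB => //; exact: measurable_funM.
Qed.

Lemma thetahat_tilt th z B : Theta th -> Theta z -> measurable B ->
  P th (thetahat @^-1` B) =
  (\int[P z]_(w in thetahat @^-1` B) (L th z (thetahat w))%:E)%E.
Proof.
move=> Tth Tz mB.
pose l x := expR ((eta th - eta z) * T x - (A th - A z)).
have ml : measurable_fun setT l.
  apply: measurableT_comp => //; apply: measurable_funB => //.
  exact: measurable_funM.
rewrite (independent_change_of_measure (P := P z) mX (indX Tz) (indX Tth) ml _ _)//.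
- apply: eq_integral => w _; rewrite /l /L -expR_sum; congr (expR _)%:E.
  rewrite big_split/= -mulr_sumr sumr_const card_ord /thetahat /sample_mean_T.
  by rewrite -[_ *+ n in LHS]mulr_natl; move: (n%:R) (lt0r_neq0 n0) => c c0; field.
- by move=> x; exact: expR_ge0.
- by move=> i C mC; exact: sample_tilt.
(* The event depends on the sample through a sum, so it lies in the sigma-algebra generated by
   cylinders. *)
have -> : thetahat @^-1` B =
    (fun w => \sum_(i < n) T (X i w)) @^-1` ((fun s => s / n%:R) @^-1` B) by [].
apply: sum_preimage_cylinders => //.
rewrite -[X in measurable X]setTI.
by have := @measurable_funM _ _ R setT id (cst n%:R^-1); apply.
Qed.

Let measurable_event (B : set R) : measurable B -> measurable (thetahat @^-1` B).
Proof. by move=> mB; rewrite -[X in measurable X]setTI; exact: measurable_thetahat. Qed.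

(** The ratio [L th z] takes the value [Mfun n eta A z th] at [z], and the last hypothesis bounds it
    by this value on [B]. Stated this way, the bound serves both tails. *)
Lemma tail_le th z (B : set R) : Theta th -> Theta z -> measurable B ->
  (forall x, B x -> (eta th - eta z) * x <= (eta th - eta z) * z) ->
  (P th (thetahat @^-1` B) <= (Mfun n eta A z th)%:E * P z (thetahat @^-1` B))%E.
Proof.
move=> Tth Tz mB H; rewrite (thetahat_tilt Tth Tz)//.
have mE := measurable_event mB.
rewrite -integral_cst//; apply: ge0_le_integral => //.
- by move=> w _; rewrite lee_fin expR_ge0.
- apply/measurable_EFinP/measurable_funTS/measurableT_comp => //.
  exact: measurable_thetahat.
- move=> w /H Hw; rewrite lee_fin MfunE ler_expR ler_wpM2l//.
  by move: Hw; rewrite mulrBl; lra.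
Qed.

Lemma upper_tail_le th z : Theta z -> Theta th -> th <= z ->
  (P th [set w | (z <= thetahat w)%R] <=
   (Mfun n eta A z th)%:E * P z [set w | (z <= thetahat w)%R])%E.
Proof.
move=> Tz Tth thz.
have -> : [set w | (z <= thetahat w)%R] = thetahat @^-1` `[z, +oo[.
  by apply/seteqP; split => w; rewrite /= in_itv/= andbT.
apply: tail_le => // x; rewrite /= in_itv/= andbT => zx.
by rewrite ler_wnM2l// subr_le0; exact: (eta_le iT dT).
Qed.

Lemma lower_tail_le th z : Theta z -> Theta th -> z <= th ->
  (P th [set w | (thetahat w <= z)%R] <=
   (Mfun n eta A z th)%:E * P z [set w | (thetahat w <= z)%R])%E.
Proof.
move=> Tz Tth zth.
have -> : [set w | (thetahat w <= z)%R] = thetahat @^-1` `]-oo, z].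
  by apply/seteqP; split => w; rewrite /= in_itv/=.
apply: tail_le => // x; rewrite /= in_itv/= => xz.
by rewrite ler_wpM2l// subr_ge0; exact: (eta_le iT dT).
Qed.

(** The tilt from [t] to [th] has total mass 1. This supplies the exponential moments assumed in
    [NaturalStatistic]. *)
Lemma mgf_TX t i th : Theta t -> Theta th ->
  (\int[P t]_w (expR ((eta th - eta t) * T (X i w)))%:E = (expR (A th - A t))%:E)%E.
Proof.
move=> Tt Tth; have := sample_tilt i Tth Tt measurableT.
rewrite preimage_setT probability_setT => H.
transitivity ((expR (A th - A t))%:E * 1)%E; last by rewrite mule1.
rewrite H -ge0_integralZl//.
- by apply: eq_integral => w _; rewrite -EFinM -expRD; congr (expR _)%:E; ring.
- apply/measurable_EFinP/measurableT_comp => //; apply: measurable_funB => //.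
  by apply: measurable_funM => //; exact: measurable_TX.
Qed.

(** * Mean and exponential moments of the sample mean *)

Hypothesis A'E : forall th, Theta th -> derive1 A th = th * derive1 eta th.

Let integrable_TX t i : Theta t -> (P t).-integrable setT (fun w => (T (X i w))%:E).
Proof.
move=> Tt; apply: (integrable_statistic iT oT dT eta'_gt0 (measurable_TX i) Tt).
by move=> th; exact: mgf_TX.
Qed.

Let mean_TX t i : Theta t -> (\int[P t]_w (T (X i w))%:E = t%:E)%E.
Proof.
move=> Tt; apply: (mean_statistic iT oT dT eta'_gt0 A'E (measurable_TX i) Tt).
by move=> th; exact: mgf_TX.
Qed.

Lemma integrable_thetahat t : Theta t -> (P t).-integrable setT (EFin \o thetahat).
Proof.
move=> Tt; have := integrableZr measurableT n%:R^-1
  (integrable_sum measurableT (index_enum 'I_n) (P := predT)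
     (fun i _ => integrable_TX i Tt)).
by apply: eq_integrable => // w _; rewrite /= sumEFin -EFinM.
Qed.

Lemma mean_thetahat t : Theta t -> (\int[P t]_w (thetahat w)%:E = t%:E)%E.
Proof.
move=> Tt.
under eq_integral do rewrite /thetahat /sample_mean_T EFinM -sumEFin.
rewrite integralZr//; last first.
  by apply: integrable_sum => // i _; exact: integrable_TX.
rewrite integral_sum//; last by move=> i; exact: integrable_TX.
under eq_bigr do rewrite mean_TX//.
by rewrite sumEFin sumr_const card_ord -EFinM -[t *+ n]mulr_natr mulfK// pnatr_eq0.
Qed.

Lemma mgf_thetahat th z t : Theta th -> Theta z ->
  (\int[P th]_w (expR (n%:R * t * (thetahat w - z)))%:E =
   (Mfun n eta A z th)%:E *
   \int[P z]_w (expR (n%:R * (t - (eta z - eta th)) * (thetahat w - z)))%:E)%E.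
Proof.
move=> Tth Tz; have mt := measurable_thetahat.
have mg c : measurable_fun setT (fun x : R => expR (c * (x - z))).
  apply: measurableT_comp => //; apply: measurable_funM => //.
  exact: measurable_funB.
have key B : measurable B ->
    (\int[P th]_(w in thetahat @^-1` B) (cst 1 w)%:E =
     \int[P z]_(w in thetahat @^-1` B) ((L th z \o thetahat) w)%:E)%E.
  move=> mB; rewrite /= integral_cst ?mul1e; last exact: measurable_event.
  exact: thetahat_tilt.
have mL : measurable_fun setT (L th z \o thetahat) by exact: measurableT_comp.
have E := integral_comp_transfer mt mt (W1 := cst 1) (measurable_cst _) mL
  (fun=> ler01) (fun x => expR_ge0 _) key (mg (n%:R * t)) (fun x => expR_ge0 _).
under eq_integral do rewrite -[expR _]mulr1.
rewrite E -ge0_integralZl//.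
(* Centred at [z], the ratio [L th z x] is [Mfun n eta A z th] times
   [expR (n%:R * (eta th - eta z) * (x - z))]. *)
- apply: eq_integral => w _; rewrite -EFinM MfunE /= /L -!expRD.
  by congr (expR _)%:E; ring.
- apply/measurable_EFinP; exact: (measurableT_comp (mg _) mt).
- by rewrite lee_fin MfunE expR_ge0.
Qed.

Lemma mgf_thetahat_attained th z : Theta th -> Theta z ->
  (\int[P th]_w (expR (n%:R * (eta z - eta th) * (thetahat w - z)))%:E =
   (Mfun n eta A z th)%:E)%E.
Proof.
move=> Tth Tz; rewrite mgf_thetahat// subrr.
under eq_integral do rewrite mulr0 mul0r expR0.
by rewrite integral_cst//= probability_setT mul1e mule1.
Qed.

Lemma mgf_thetahat_ge th z t : Theta th -> Theta z ->
  ((Mfun n eta A z th)%:E <=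
   \int[P th]_w (expR (n%:R * t * (thetahat w - z)))%:E)%E.
Proof.
move=> Tth Tz; rewrite mgf_thetahat//.
set c := n%:R * _; rewrite -[leLHS]mule1 lee_pmul2l//; last first.
  by rewrite lte_fin MfunE expR_gt0.
have it := integrable_thetahat Tz.
have i1 c' : (P z).-integrable setT (fun=> c'%:E).
  exact: finite_measure_integrable_cst.
(* The affine minorant of the exponential has mean 1 because the sample mean has mean [z] under
   [P z]. *)
have E1 : (\int[P z]_w (1 - c * z + c * thetahat w)%:E = 1)%E.
  under eq_integral do rewrite EFinD EFinM.
  rewrite integralD//; last exact: integrableZl.
  rewrite integralZl// mean_thetahat// integral_cst//= probability_setT mule1.
  by rewrite -EFinM -EFinD subrK.
set J := (\int[P z]_w (expR (c * (thetahat w - z)))%:E)%E.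
have mexp : measurable_fun setT (fun w => expR (c * (thetahat w - z))).
  apply: measurableT_comp => //; apply: measurable_funM => //.
  by apply: measurable_funB => //; exact: measurable_thetahat.
(* The exponential moment may be infinite for some [c]; when finite, it gives the integrability that
   [le_integral] requires. *)
have [->|Jfin] := eqVneq J +oo%E; first exact: leey.
rewrite -E1; apply: le_integral => //.
- under eq_fun do rewrite EFinD EFinM.
  by apply: integrableD => //; exact: integrableZl.
- apply/integrableP; split; first exact/measurable_EFinP.
  under eq_integral do rewrite /= ger0_norm ?expR_ge0//.
  by rewrite ltey.
- move=> w _; rewrite lee_fin; apply: le_trans (expR_ge1Dx _).
  by rewrite mulrBr; lra.
Qed.

(** * Berry-Esseen bounds at the true parameter *)

Let m j z := abs_moment mu h T eta A j z.

Lemma abs_momentE j z i : Theta z ->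
  m j z = fine (\int[P z]_w (`|T (X i w) - z| ^+ j)%:E)%E.
Proof.
move=> Tz; rewrite /m /abs_moment.
rewrite (integral_sample i (g := fun x => `|T x - z| ^+ j) Tz)//.
apply: measurable_funX; apply: measurableT_comp => //; exact: measurable_funB.
Qed.

(** Finiteness ensures that [fine] in [abs_moment] returns the true moment and not its default value
    0. *)
Let integrable_moment j z i : Theta z ->
  (P z).-integrable setT (fun w => (`|T (X i w) - z| ^+ j.+1)%:E).
Proof.
move=> Tz.
by apply: (integrable_statistic_pow iT oT dT eta'_gt0 (measurable_TX i) Tz) => th; exact: mgf_TX.
Qed.

Lemma abs_moment_gt0 j z : Theta z -> 0 < m j.+1 z.
Proof.
move=> Tz; rewrite (abs_momentE _ ord0)//.
by apply: (central_moment_gt0 iT oT dT eta'_gt0 A'E (measurable_TX ord0) Tz) => th; exact: mgf_TX.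
Qed.

Lemma abs_moment3_le z : Theta z -> m 3 z <= powR (m 4 z) (3 / 4).
Proof.
move=> Tz; have := abs_moment_gt0 3 Tz; rewrite !(abs_momentE _ ord0)// => m40.
by apply: third_moment_le => //; exact: integrable_moment.
Qed.

(* The sign [s] gives both tails without left limits of the cdf. *)
Lemma BE_signed_sum (C : R) z s : BE_constant C -> Theta z -> `|s| = 1 ->
  `| fine (P z [set w | \sum_(i < n) s * (T (X i w) - z) <= 0]) - 1 / 2 | <=
  C / Num.sqrt n%:R * (m 3 z / powR (m 2 z) (3 / 2)).
Proof.
move=> HC Tz s1.
pose f x := s * (T x - z).
have mf : measurable_fun setT f.
  by apply: measurable_funM => //; exact: measurable_funB.
pose Y i := f \o X i.
have mY i : measurable_fun setT (Y i) by exact: measurableT_comp.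
have mfB B : measurable B -> measurable (f @^-1` B).
  by move=> mB; rewrite -[X in measurable X]setTI; exact: mf.
have indY : mutually_independent (P z) Y.
  move=> B mB; have := indX Tz (B := fun i => f @^-1` B i).
  by apply=> i; exact: mfB.
have idY i j (B : set R) : measurable B -> P z (Y i @^-1` B) = P z (Y j @^-1` B).
  by move=> /mfB mB; exact: etrans (lawX i Tz mB) (esym (lawX j Tz mB)).
have absY j w : `|Y ord0 w| ^+ j = `|T (X ord0 w) - z| ^+ j.
  by rewrite /Y /f /= normrM s1 mul1r.
have i3 : (P z).-integrable setT (fun w => (`|Y ord0 w| ^+ 3)%:E).
  by under eq_fun do rewrite absY; exact: integrable_moment.
have m3 : (('E_(P z)[fun w => (`|Y ord0 w| ^+ 3)%R]) = (m 3 z)%:E)%E.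
  rewrite unlock (abs_momentE _ ord0)// fineK; last first.
    by apply: integrable_fin_num => //; exact: integrable_moment.
  by apply: eq_integral => w _; rewrite absY.
have m2 : (('E_(P z)[fun w => (Y ord0 w ^+ 2)%R]) = (m 2 z)%:E)%E.
  rewrite unlock (abs_momentE _ ord0)// fineK; last first.
    by apply: integrable_fin_num => //; exact: integrable_moment.
  by apply: eq_integral => w _; rewrite -absY real_normK// num_real.
have E0 : ('E_(P z)[Y ord0] = 0)%E.
  rewrite unlock /Y /f /=; under eq_integral do rewrite mulrBr EFinB EFinM.
  rewrite integralB//.
  - rewrite integralZl// ?mean_TX// ?integral_cst//=; last exact: integrable_TX.
    by rewrite probability_setT mule1 -EFinM -EFinB subrr.
  - by apply: integrableZl => //; exact: integrable_TX.
  - exact: finite_measure_integrable_cst.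
have := HC d Om (P z) k Y mY indY idY i3 E0.
rewrite m2 m3 /= lte_fin => /(_ (abs_moment_gt0 1 Tz) 0).
rewrite Phi0; set E1 := [set w | _]; set E2 := [set w | _].
have -> // : E1 = E2.
(* At the threshold 0, dividing the sum by a positive standard deviation leaves the event
   unchanged. *)
have q0 : 0 < Num.sqrt (n%:R * m 2 z) by rewrite sqrtr_gt0 mulr_gt0// abs_moment_gt0.
by apply/seteqP; split => w; rewrite /E1 /E2 /= ler_pdivrMr// mul0r.
Qed.

(** A positive multiple of [C] bounds an absolute value. The sign is what lets the third moment be
    replaced by a larger quantity. *)
Lemma BE_constant_ge0 (C : R) z : BE_constant C -> Theta z -> 0 <= C.
Proof.
move=> HC Tz; have := BE_signed_sum HC Tz (normr1 R).
move=> /(le_trans (normr_ge0 _)); rewrite pmulr_lge0.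
  by rewrite pmulr_lge0// invr_gt0 sqrtr_gt0.
by rewrite divr_gt0 ?powR_gt0// abs_moment_gt0.
Qed.

(** The slot [q] receives either the third moment or the power of the fourth that majorises it. *)
Let bound q z C := 1 / 2 + C / Num.sqrt n%:R * (q / powR (m 2 z) (3 / 2)).

Lemma BE_bound_le (C : R) z : BE_constant C -> Theta z ->
  bound (m 3 z) z C <= bound (powR (m 4 z) (3 / 4)) z C.
Proof.
move=> HC Tz; have C0 := BE_constant_ge0 HC Tz.
rewrite lerD2l ler_wpM2l ?divr_ge0 ?sqrtr_ge0// ler_pM2r ?abs_moment3_le//.
by rewrite invr_gt0 powR_gt0// abs_moment_gt0.
Qed.

(** Taking [s = -1] gives the upper tail and [s = 1] the lower one, each with its boundary point. *)
Let tail_BE (C : R) z s (E : set Om) : BE_constant C -> Theta z -> `|s| = 1 ->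
  measurable E -> E = [set w | \sum_(i < n) s * (T (X i w) - z) <= 0] ->
  (P z E <= (bound (m 3 z) z C)%:E)%E.
Proof.
move=> HC Tz s1 mE EE; rewrite -[leLHS]fineK ?fin_num_measure// lee_fin /bound.
have := BE_signed_sum HC Tz s1; rewrite -EE ler_norml => /andP[_].
by rewrite lerBlDl.
Qed.

Let sum_signed z s w : \sum_(i < n) s * (T (X i w) - z) = n%:R * (s * (thetahat w - z)).
Proof.
rewrite -mulr_sumr big_split/= sumr_const card_ord /thetahat /sample_mean_T.
rewrite -[_ *+ n in LHS]mulr_natl; move: (n%:R) (lt0r_neq0 n0) => c c0; field.
exact: c0.
Qed.

Lemma upper_tail_BE (C : R) z : BE_constant C -> Theta z ->
  (P z [set w | (z <= thetahat w)%R] <= (bound (m 3 z) z C)%:E)%E.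
Proof.
move=> HC Tz; apply: (tail_BE (s := -1) HC Tz); first by rewrite normrN1.
  rewrite (_ : [set w | _] = thetahat @^-1` `[z, +oo[); first exact: measurable_event.
  by apply/seteqP; split => w; rewrite /= in_itv/= andbT.
apply/seteqP; split => w; rewrite /= sum_signed pmulr_rle0// mulN1r opprB subr_le0//.
Qed.

Lemma lower_tail_BE (C : R) z : BE_constant C -> Theta z ->
  (P z [set w | (thetahat w <= z)%R] <= (bound (m 3 z) z C)%:E)%E.
Proof.
move=> HC Tz; apply: (tail_BE (s := 1) HC Tz); first by rewrite normr1.
  rewrite (_ : [set w | _] = thetahat @^-1` `]-oo, z]); first exact: measurable_event.
  by apply/seteqP; split => w; rewrite /= in_itv/=.
apply/seteqP; split => w; rewrite /= sum_signed pmulr_rle0// mul1r subr_le0//.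
Qed.

End IIDSample.

Unset Implicit Arguments.
Set Strict Implicit.
Set Printing Implicit Defensive.

Theorem theorem3 (R : realType) (Theta : set R) (h T eta A : R -> R)
  (mu : {measure set R -> \bar R})
  (d : measure_display) (Om : measurableType d) (P : R -> probability Om R)
  (n : nat) (X : 'I_n -> Om -> R) :
  is_interval Theta -> open Theta -> (exists t, Theta t) ->
  (* pdf (w.r.t. Lebesgue measure) or pmf (w.r.t. counting measure) *)
  ((mu : set R -> \bar R) = lebesgue_measure \/ (mu : set R -> \bar R) = counting) ->
  measurable_fun setT h -> (forall x, 0 <= h x) -> measurable_fun setT T ->
  (forall th, Theta th -> derivable eta th 1 /\ derivable A th 1) ->
  (0 < n)%N ->
  (forall i, measurable_fun setT (X i)) ->
  (* under parameter th, X_1..X_n are i.i.d. with density f_X(., th) *)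
  (forall th, Theta th -> mutually_independent (P th) X) ->
  (forall th i (B : set R), Theta th -> measurable B ->
     P th (X i @^-1` B) = (\int[mu]_(x in B) (expfam_density h T eta A x th)%:E)%E) ->
  (forall th, Theta th -> 0 < derive1 eta th) ->
  let thetahat := fun w => sample_mean_T T (fun i => X i w) in
  let M := Mfun n eta A in
  ((forall z th, Theta z -> Theta th -> th <= z ->
      (P th [set w | (z <= thetahat w)%R] <= (M z th)%:E * P z [set w | (z <= thetahat w)%R])%E) /\
   (forall z th, Theta z -> Theta th -> z <= th ->
      (P th [set w | (thetahat w <= z)%R] <= (M z th)%:E * P z [set w | (thetahat w <= z)%R])%E)) /\
  ((forall th, Theta th -> derive1 A th = th * derive1 eta th) ->
   (* (i) maximum likelihood and unbiased *)
   ((forall x : 'I_n -> R, Theta (sample_mean_T T x) ->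
       forall th, Theta th ->
         likelihood h T eta A x th <= likelihood h T eta A x (sample_mean_T T x)) /\
    (forall th, Theta th ->
       (P th).-integrable setT (EFin \o thetahat) /\
       ('E_(P th)[thetahat] = th%:E)%E)) /\
   (* (ii) Chernoff bound is M, attained at eta z - eta th *)
   (forall z th, Theta z -> Theta th ->
      let mgf := fun t : R =>
        (\int[P th]_w (expR (n%:R * t * (thetahat w - z)))%:E)%E in
      (M z th)%:E = ereal_inf [set mgf t | t in [set: R]] /\
      mgf (eta z - eta th) = (M z th)%:E) /\
   (* (iii) monotonicity in th *)
   (forall z, Theta z ->
      (forall th1 th2, Theta th1 -> Theta th2 -> th1 <= th2 -> th2 <= z ->
         M z th1 <= M z th2) /\
      (forall th1 th2, Theta th1 -> Theta th2 -> z <= th1 -> th1 <= th2 ->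
         M z th2 <= M z th1)) /\
   (* (iv) monotonicity in z *)
   (forall th, Theta th ->
      (forall z1 z2, Theta z1 -> Theta z2 -> z1 <= z2 -> z2 <= th ->
         M z1 th <= M z2 th) /\
      (forall z1 z2, Theta z1 -> Theta z2 -> th <= z1 -> z1 <= z2 ->
         M z2 th <= M z1 th)) /\
   (* (v) Berry--Esseen bounds, for any valid Berry--Esseen constant C *)
   (forall C : R, BE_constant C -> forall z, Theta z ->
      let m2 := abs_moment mu h T eta A 2 z in
      let m3 := abs_moment mu h T eta A 3 z in
      let m4 := abs_moment mu h T eta A 4 z in
      let B3 := 1 / 2 + C / Num.sqrt n%:R * (m3 / powR m2 (3 / 2)) in
      let B4 := 1 / 2 + C / Num.sqrt n%:R * (powR m4 (3 / 4) / powR m2 (3 / 2)) in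
      ((P z [set w | (z <= thetahat w)%R] <= B3%:E)%E /\ B3 <= B4) /\
      ((P z [set w | (thetahat w <= z)%R] <= B3%:E)%E /\ B3 <= B4))).
Proof.
(* A positive sample size is put in the successor form in which [BE_constant] is stated. *)
case: n X => [//|k] {}X iT oT _ _ mh h0 mT dT _ mX indX lawX e0 thetahat M.
split; first split => z th Tz Tth.
- exact: (upper_tail_le iT mh h0 mT dT mX indX lawX e0).
- exact: (lower_tail_le iT mh h0 mT dT mX indX lawX e0).
move=> A'E; split; [split|split; [|split; [|split]]].
- move=> x Tx th Tth; rewrite !likelihoodE// ler_wpM2l ?prodr_ge0//.
  by rewrite ler_expR ler_wpM2l//; exact: (loglik_le_max iT dT e0 A'E).
- move=> th Tth; split; first exact: (integrable_thetahat iT oT mh h0 mT dT mX lawX e0).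
  by rewrite unlock; exact: (mean_thetahat iT oT mh h0 mT dT mX lawX e0 A'E).
- move=> z th Tz Tth mgf.
  have att : mgf (eta z - eta th) = (M z th)%:E.
    exact: (mgf_thetahat_attained mh h0 mT mX indX lawX).
  (* M is a lower bound of all the exponential moments and, by [att], one of them. *)
  split=> //; apply/eqP; rewrite eq_le; apply/andP; split.
    apply: le_ereal_inf_tmp => _ [t _ <-].
    exact: (mgf_thetahat_ge iT oT mh h0 mT dT mX indX lawX e0 A'E).
  by rewrite -att; apply: ereal_inf_lbound; exists (eta z - eta th).
- exact: (Mfun_unimodal_param _ iT dT e0 A'E).
- exact: (Mfun_unimodal_point _ iT dT e0 A'E).
move=> C HC z Tz m2 m3 m4 B3 B4.
have B34 : B3 <= B4.
  exact: (BE_bound_le iT oT mh h0 mT dT mX indX lawX e0 A'E).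
split; split => //.
- exact: (upper_tail_BE iT oT mh h0 mT dT mX indX lawX e0 A'E).
- exact: (lower_tail_BE iT oT mh h0 mT dT mX indX lawX e0 A'E).
Qed.
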